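(* For every finite graph $G$ and every edge $e\in E(G)$, there is an isomorphism of $\mathbb Z^3$-graded $\mathbf k$-vector spaces $$\mathcal N_0(G)\cong\mathcal N_0(G/e)\{0,1,0\}\oplus\mathcal N_0(G-e)\{0,0,1\}.$$
   Context: Graphs are finite and may have loops and multiple edges. $G-e$ is deletion of $e$ and $G/e$ is contraction of $e$ (identify its endpoints and remove $e$, keeping all other edges); contraction of a loop is identified with deletion, i.e. $G/e=G-e$ if $e$ is a loop. For $S\subseteq E(G)$, $\omega_G(S)$ denotes the number of connected components of the spanning subgraph $(V(G),S)$. Let $\mathbf k$ be a field. For a finite-dimensional $\mathbb Z^3$-graded $\mathbf k$-vector space $M$, the grading shift is $M\{a,b,c\}_{i,j,k}=M_{i-a,j-b,k-c}$; in particular $\mathbf k\{a,b,c\}$ is one-dimensional, concentrated in degree $(a,b,c)$. The Negami state object is $$\mathcal N_0(G)=\bigoplus_{S\subseteq E(G)}\mathbf k\{\omega_G(S),|S|,|E(G)|-|S|\}.$$ *)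

(* Defs.v *)
From HB Require Import structures.
From mathcomp Require Import all_boot all_order all_algebra.

Set Implicit Arguments.
Unset Strict Implicit.
Unset Printing Implicit Defensive.

Import GRing.Theory.

(* Finite graphs with loops and multiple edges: the edges form a finite type of
   their own, and an edge has one end (a loop) or two. *)
Record mgraph := MGraph {
  vertex : finType;
  edge : finType;
  ends : edge -> {set vertex};
  ends_card : forall f, 0 < #|ends f| <= 2
}.

Definition is_loop (G : mgraph) (e : edge G) : bool := #|ends e| == 1.

Section DeletionContraction.
Variables (G : mgraph) (e : edge G).

Definition delete : mgraph :=
  @MGraph (vertex G) {f : edge G | f != e}
    (fun f => ends (val f)) (fun f => ends_card (val f)).

(* The class of v once the ends of e are identified. *)
Definition merge_class (v : vertex G) : {set vertex G} :=
  if v \in ends e then ends e else [set v].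

Definition merged_vertex : finType :=
  {B : {set vertex G} | B \in [set merge_class v | v : vertex G]}.

Definition merge (v : vertex G) : merged_vertex :=
  exist _ (merge_class v) (imset_f merge_class isT).

Lemma merge_ends_card (f : {f : edge G | f != e}) :
  0 < #|merge @: ends (val f)| <= 2.
Proof.
have /andP[f0 f2] := ends_card (val f).
rewrite (leq_trans (leq_imset_card _ _) f2) andbT.
have /card_gt0P[v fv] := f0.
by apply/card_gt0P; exists (merge v); apply: imset_f.
Qed.

Definition identify_ends : mgraph :=
  @MGraph merged_vertex {f : edge G | f != e}
    (fun f => merge @: ends (val f)) merge_ends_card.

Definition contract : mgraph := if is_loop e then delete else identify_ends.

End DeletionContraction.

Definition adj (G : mgraph) (S : {set edge G}) : rel (vertex G) :=
  fun u v => [exists f in S, (u \in ends f) && (v \in ends f)].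

(* n_comp counts connected components only for relations with this property. *)
Lemma adj_connect_sym (G : mgraph) (S : {set edge G}) : connect_sym (adj S).
Proof.
apply: sym_connect_sym => u v; apply: eq_existsb => f.
by rewrite [X in _ && X]andbC.
Qed.

Definition omega (G : mgraph) (S : {set edge G}) : nat :=
  n_comp (adj S) (vertex G).

Local Open Scope ring_scope.

Definition Z3 : zmodType := (int * int * int)%type.

(* Finite-dimensional Z^3-graded vector spaces: the homogeneous components are
   finite-dimensional and almost all of them vanish. *)
Record gvect (K : fieldType) := GVect {
  gcomp :> Z3 -> vectType K;
  gcomp_fin : exists s : seq Z3, forall d, d \notin s -> \dim {: gcomp d} = 0%N
}.

Section GradedSpaces.
Variable K : fieldType.
Implicit Types (M N : gvect K) (s d : Z3).

Definition giso M N : Prop :=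
  exists f : forall d, {linear M d -> N d}, forall d, bijective (f d).

Lemma gzero_fin :
  exists s : seq Z3, forall d, d \notin s -> \dim {: 'rV[K]_0} = 0%N.
Proof. by exists [::] => d _; rewrite dimvf. Qed.

Definition gzero : gvect K := @GVect K (fun=> 'rV[K]_0) gzero_fin.

Definition gsum_comp M N d : vectType K := (M d * N d)%type.

Lemma gsum_fin M N :
  exists s : seq Z3, forall d, d \notin s -> \dim {: gsum_comp M N d} = 0%N.
Proof.
have [s Ms] := gcomp_fin M; have [t Nt] := gcomp_fin N.
exists (s ++ t) => d; rewrite mem_cat negb_or => /andP[/Ms + /Nt].
by rewrite !dimvf /= => Md Nd; rewrite -[LHS]/(dim _ + dim _)%N Md Nd.
Qed.

Definition gsum M N : gvect K := GVect (gsum_fin M N).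

Lemma gshift_fin M s :
  exists t : seq Z3, forall d, d \notin t -> \dim {: M (d - s)} = 0%N.
Proof.
have [t Mt] := gcomp_fin M; exists [seq d + s | d <- t] => d dt; apply: Mt.
by apply: contra dt => dt; apply/mapP; exists (d - s); rewrite ?subrK.
Qed.

Definition gshift M s : gvect K := GVect (gshift_fin M s).

Definition gunit_comp d : vectType K :=
  if d == 0 then (K^o : vectType K) else 'rV[K]_0.

Lemma gunit_fin :
  exists s : seq Z3, forall d, d \notin s -> \dim {: gunit_comp d} = 0%N.
Proof.
exists [:: 0] => d; rewrite inE /gunit_comp => /negPf->.
by rewrite dimvf.
Qed.

(* The ground field, in degree (0, 0, 0). *)
Definition gunit : gvect K := GVect gunit_fin.

Definition negami0 (G : mgraph) : gvect K :=
  \big[gsum/gzero]_(S : {set edge G})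
    gshift gunit ((omega S)%:Z, #|S|%:Z, #|edge G|%:Z - #|S|%:Z).

End GradedSpaces.

(* Main.v *)
From HB Require Import structures.
Require Import Defs.
From mathcomp Require Import all_boot all_order all_algebra.

(** A graded isomorphism is nothing but an equality of dimensions in every
    degree ([eq_dim_giso]), and the dimension of [negami0 K G] in degree [d] is
    the number of edge sets [S] whose degree [(omega S, #|S|, #|E| - #|S|)] is
    [d] ([dim_negami0]).  The theorem is thus a count of the edge sets [S] of
    [G], split according to whether they contain [e].

    Both kinds of [S] correspond to the sets [T] of edges other than [e], which
    are the edge sets of [G - e] and of [G / e] alike: [S = T] if [S] avoids
    [e], and [S = e |: T] otherwise ([sum_set_split]).  Since
    [G - e] and [G / e] have one edge less than [G], passing from [S] to [T]
    loses one edge of the complement in the first case and one edge of the set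
    in the second: these are the two shifts.  It remains to see that the number of
    components agrees.  For [S = T] in [G - e] the two spanning subgraphs are
    the same ([omega_delete]).  For [S = e |: T] in [G / e], two vertices are
    joined in [S] if and only if their images are joined in [T], because the
    only vertices that contraction identifies are the ends of [e], which [S]
    joins ([omega_identify_ends]); when [e] is a loop, it joins no two distinct
    vertices and may as well be deleted ([omega_delete_loop]). *)

Set Implicit Arguments.
Unset Strict Implicit.
Unset Printing Implicit Defensive.

Import GRing.Theory passmx.
(* so that [merge] is the map to the contracted graph, not the merge of lists *)
Import Defs.

Local Open Scope ring_scope.

(** * Graded dimension *)

Section GradedDimension.
Variable K : fieldType.
Implicit Types (M N : gvect K) (s d : Z3).

(** The coordinates in fixed bases give an explicit map in each degree, so that
    no choice is needed to collect these maps into one function of the degree. *)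
Lemma eq_dim_giso M N :
  (forall d, \dim {: M d} = \dim {: N d}) -> giso M N.
Proof.
move=> eqMN.
pose f d (x : M d) : N d :=
  vecof (vbasis {: N d})
    (castmx (erefl 1%N, eqMN d) (rVof (vbasis {: M d}) x)).
have f_lin d : linear (@f d).
  move=> a x y; rewrite /f -linearP; congr vecof.
  by apply/rowP => i; rewrite linearP !(castmxE, mxE).
pose fL d : {linear M d -> N d} :=
  HB.pack (@f d) (GRing.isLinear.Build _ _ _ _ (@f d) (f_lin d)).
exists fL => d.
exists (fun y => vecof (vbasis {: M d})
  (castmx (erefl 1%N, esym (eqMN d)) (rVof (vbasis {: N d}) y))) => x /=.
  by rewrite /f (vecofK (vbasisP _)) castmx_comp castmx_id (rVofK (vbasisP _)).
by rewrite /f (vecofK (vbasisP _)) castmx_comp castmx_id (rVofK (vbasisP _)).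
Qed.

Lemma dim_gsum M N d : dim (gsum M N d) = (dim (M d) + dim (N d))%N.
Proof. by []. Qed.

Lemma dim_big_gsum (I : finType) (F : I -> gvect K) d :
  dim ((\big[@gsum K/gzero K]_i F i) d) = (\sum_i dim (F i d))%N.
Proof.
by apply: (big_morph (fun M : gvect K => dim (M d))) => [M N|]; rewrite ?dim_gsum.
Qed.

Lemma dim_gshift_gunit s d : dim (gshift (gunit K) s d) = (d == s :> Z3).
Proof. by rewrite /= /gunit_comp subr_eq0; case: eqP. Qed.

Definition negami_degree (G : mgraph) (S : {set edge G}) : Z3 :=
  ((omega S)%:Z, #|S|%:Z, #|edge G|%:Z - #|S|%:Z).

Lemma dim_negami0 (G : mgraph) d :
  dim (negami0 K G d) = (\sum_(S : {set edge G}) (d == negami_degree S))%N.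
Proof.
by rewrite dim_big_gsum; apply: eq_bigr => S _; rewrite dim_gshift_gunit.
Qed.

Lemma dim_gshift_negami0 (G : mgraph) s d :
  dim (gshift (negami0 K G) s d) =
  (\sum_(S : {set edge G}) (d == negami_degree S + s)%R)%N.
Proof.
rewrite [LHS]dim_negami0; apply: eq_bigr => S _.
by rewrite subr_eq.
Qed.

End GradedDimension.

(** * Sets with and without a given element *)

Section SplitSets.
Variables (E : finType) (e : E).
Implicit Types T : {set {f : E | f != e}}.

Lemma notin_imset_val T : e \notin val @: T.
Proof. by apply/imsetP => -[f _ ef]; have := valP f; rewrite -ef eqxx. Qed.

Lemma card_imset_val T : #|val @: T| = #|T|.
Proof. exact: card_imset val_inj. Qed.

Lemma card_setU1_val T : #|e |: val @: T| = #|T|.+1.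
Proof. by rewrite cardsU1 notin_imset_val card_imset_val. Qed.

Lemma card_sub_neq : #|E| = #|{: {f : E | f != e}}|.+1.
Proof.
rewrite card_sig (cardD1 e) add1n; congr _.+1.
by apply: eq_card => f; rewrite !inE andbT.
Qed.

Lemma imset_valK : cancel (fun T => val @: T) (fun S => val @^-1: S).
Proof. by move=> T; apply/setP => f; rewrite inE mem_imset //; apply: val_inj. Qed.

Lemma setU1_valK : cancel (fun T => e |: val @: T) (fun S => val @^-1: S).
Proof.
move=> T; apply/setP => f; rewrite !inE mem_imset ?(negPf (valP f)) //.
exact: val_inj.
Qed.

Lemma imset_preim_val (S : {set E}) :
  val @: (val @^-1: S : {set {f : E | f != e}}) = S :\ e.
Proof.
apply/setP => f; rewrite !inE; apply/imsetP/andP => [[g]|[fe Sf]].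
  by rewrite inE => Sg ->; split=> //; apply: (valP g).
by exists (exist _ f fe); rewrite ?inE.
Qed.

Lemma sum_set_split (F : {set E} -> nat) :
  (\sum_S F S =
   \sum_(T : {set {f | f != e}}) F (e |: val @: T) +
   \sum_(T : {set {f | f != e}}) F (val @: T))%N.
Proof.
rewrite (bigID (fun S : {set E} => e \in S)) /=; congr addn.
  rewrite (reindex_onto (fun T : {set {f | f != e}} => e |: val @: T)
            (fun S => val @^-1: S)).
    by apply: eq_bigl => T; rewrite setU11 setU1_valK eqxx.
  by move=> S eS; rewrite imset_preim_val setD1K.
rewrite (reindex_onto (fun T : {set {f | f != e}} => val @: T)
            (fun S => val @^-1: S)).
  by apply: eq_bigl => T; rewrite notin_imset_val imset_valK eqxx.
move=> S eS; rewrite imset_preim_val; apply/setDidPl.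
by rewrite disjoint_sym disjoints1.
Qed.

End SplitSets.

(** * Components under deletion and contraction *)

Section Components.
Variables (G : mgraph) (e : edge G).

Lemma adjI (H : mgraph) (S : {set edge H}) f u v :
  f \in S -> u \in ends f -> v \in ends f -> adj S u v.
Proof. by move=> Sf fu fv; apply/existsP; exists f; rewrite Sf fu. Qed.

Lemma adjP (H : mgraph) (S : {set edge H}) u v :
  reflect (exists2 f, f \in S & u \in ends f /\ v \in ends f) (adj S u v).
Proof.
apply: (iffP existsP) => [[f /and3P[Sf fu fv]]|[f Sf [fu fv]]]; exists f => //.
by rewrite Sf fu.
Qed.

Lemma adj_delete (T : {set edge (delete e)}) :
  @adj G (val @: T) =2 adj T.
Proof.
move=> u v; apply/adjP/adjP => [[_ /imsetP[f Tf ->] fuv]|[f Tf fuv]].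
  by exists f.
by exists (val f) => //; apply: imset_f.
Qed.

Lemma omega_delete (T : {set edge (delete e)}) :
  omega (val @: T : {set edge G}) = omega T.
Proof. exact/eq_n_comp/eq_connect/adj_delete. Qed.

Lemma omega_delete_loop (T : {set edge (delete e)}) :
  is_loop e -> omega (e |: val @: T : {set edge G}) = omega T.
Proof.
move=> /cards1P[x ex]; rewrite -omega_delete.
apply: eq_n_comp => u v; apply/idP/idP; apply: connect_sub => {}u {}v /adjP[f].
  rewrite in_setU1 => /predU1P[->|Tf [fu fv]]; last exact/connect1/(adjI Tf).
  by rewrite ex => -[/set1P-> /set1P->].
by move=> Tf [fu fv]; apply/connect1/(adjI _ fu fv); rewrite in_setU1 Tf orbT.
Qed.

Lemma merge_ends u v : u \in ends e -> v \in ends e -> merge e u = merge e v.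
Proof. by move=> eu ev; apply: val_inj; rewrite /= /merge_class eu ev. Qed.

Lemma merge_eq u v :
  merge e u = merge e v -> u = v \/ u \in ends e /\ v \in ends e.
Proof.
move=> /(congr1 val) /=; rewrite /merge_class.
case: ifP => eu; case: ifP => ev; first by right.
- by move=> Ev; rewrite Ev inE in eu *; move/eqP: eu; left.
- by move=> Ev; left; apply/esym/set1P; rewrite Ev.
by move/set1_inj; left.
Qed.

(** A path of [G / e] lifts step by step: consecutive edges of the path may
    meet [merge x] at different vertices of [G], but these are then ends of
    [e], so that inserting [e] closes the gap. *)
Lemma connect_merge (T : {set edge (identify_ends e)}) x y :
  @connect (vertex G) (@adj G (e |: val @: T)) x y =
  connect (adj T) (merge e x : vertex (identify_ends e)) (merge e y).
Proof.
set S := e |: val @: T.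
have Se : e \in S by rewrite setU11.
have ST (g : edge (identify_ends e)) : g \in T -> val g \in S.
  by move=> Tg; rewrite in_setU1 imset_f ?orbT.
have connect_fiber u v : merge e u = merge e v -> connect (@adj G S) u v.
  by case/merge_eq => [->|[eu ev]] //; apply/connect1/(adjI Se).
apply/idP/idP => [/connectP[p]|/connectP[p]].
  elim: p x => [x _ ->|z p IHp x /= /andP[/adjP[f Sf [fx fz]] zp] yE] //.
  apply: connect_trans (IHp z zp yE); move: Sf.
  rewrite in_setU1 => /predU1P[fe|/imsetP[g Tg fg]].
    by rewrite (@merge_ends x z) -?fe.
  by apply/connect1/(adjI Tg); apply: imset_f; rewrite -fg.
elim: p x => [x _ yE|B p IHp x /= /andP[/adjP[g Tg [gx gB]] Bp] yE].
  exact/connect_fiber.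
case/imsetP: gx => x' gx' xx'; case/imsetP: gB => z gz Bz.
rewrite Bz in Bp yE.
apply: connect_trans (connect_fiber _ _ xx') _.
exact: connect_trans (connect1 (adjI (ST g Tg) gx' gz)) (IHp z Bp yE).
Qed.

(** Components correspond along [merge], which is onto the vertices of the
    contracted graph and preserves and reflects connectedness. *)
Lemma omega_identify_ends (T : {set edge (identify_ends e)}) :
  omega (e |: val @: T : {set edge G}) = omega T.
Proof.
symmetry; apply: (@adjunction_n_comp _ _ (merge e)).
- exact: (@adj_connect_sym (identify_ends e) T).
- exact: (@adj_connect_sym G).
- by [].
split=> [B _|x y _]; last exact: connect_merge.
have /imsetP/sig2_eqW[v _ Bv] := valP B; exists v.
by rewrite (_ : B = merge e v) //; apply: val_inj.
Qed.

End Components.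

(** * Deletion-contraction *)

Theorem theorem3p3 (K : fieldType) (G : mgraph) (e : edge G) :
  giso (negami0 K G)
       (gsum (gshift (negami0 K (contract e)) (0, 1, 0))
             (gshift (negami0 K (delete e)) (0, 0, 1))).
Proof.
have cardE := card_sub_neq e.
apply: eq_dim_giso => d.
rewrite !dimvf dim_gsum !dim_gshift_negami0 dim_negami0 (sum_set_split e).
congr addn; last first.
  apply: eq_bigr => T _; congr (nat_of_bool (d == _)).
  rewrite /negami_degree omega_delete card_imset_val cardE intS.
  by congr (_, _, _); rewrite ?addr0 // -addrA addrC.
have degree_setU1 n (T : {set {f : edge G | f != e}}) :
    (n%:Z, #|e |: val @: T|%:Z, #|edge G|%:Z - #|e |: val @: T|%:Z) =
    (n%:Z, #|T|%:Z, #|{: {f : edge G | f != e}}|%:Z - #|T|%:Z) + (0, 1, 0) :> Z3.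
  rewrite card_setU1_val cardE !intS.
  congr (_, _, _); rewrite ?addr0 //; first by rewrite addrC.
  by rewrite opprD addrACA subrr add0r.
rewrite /contract; case: ifP => e_loop.
  apply: eq_bigr => T _; congr (nat_of_bool (d == _)).
  by rewrite /negami_degree omega_delete_loop // degree_setU1.
apply: eq_bigr => T _; congr (nat_of_bool (d == _)).
by rewrite /negami_degree omega_identify_ends degree_setU1.
Qed.
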